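(* Let $C>1$ and $r,\ell>1$ with $(800C^4)^2r^{1/3}<\ell<r^{2/3}$. Let $w\in(0,1)$ and suppose $\ell/(25r)<|w-a/q|\le 1/(q r^{1/3})$ for some irreducible rational $a/q$ with $1\le q<800C^4r^{2/3}/\ell$. Then there exists a curve $\Gamma\subset\mathbb R^2$ such that (i) $\Gamma$ is twice differentiable and its radius of curvature always lies in $[r/16,16r]$; (ii) the length of $\Gamma$ is less than $\ell$; (iii) the initial slope of $\Gamma$ is $w$; (iv) $|\Gamma\cap\mathbb Z^2|\ge \frac14+\frac14\,\frac{1}{(800C^4)^6}\,q\ell\left|w-\frac aq\right|$. *)

(* Defs.v *)
From Stdlib Require Import Reals ZArith Ensembles Finite_sets.
From Coquelicot Require Import Coquelicot.
Open Scope R_scope.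

Record curve := Curve {
  t_init : R;
  t_final : R;
  cx : R -> R;
  cy : R -> R;
  t_init_lt_final : t_init < t_final }.

(* The functions cx, cy are total, but only their restriction to
   [t_init, t_final] belongs to the curve. *)
Definition in_domain (G : curve) (t : R) : Prop := t_init G <= t <= t_final G.

Definition trace (G : curve) : Ensemble (R * R) :=
  fun p => exists t, in_domain G t /\ p = (cx G t, cy G t).

(* Derivatives are two-sided, also at the endpoints: a map on a closed interval
   with one-sided derivatives at the ends extends to such a map on R. *)
Definition twice_differentiable (G : curve) : Prop :=
  forall t, in_domain G t ->
    ex_derive (cx G) t /\ ex_derive (cy G) t /\
    ex_derive (Derive (cx G)) t /\ ex_derive (Derive (cy G)) t.

Definition regular (G : curve) : Prop :=
  forall t, in_domain G t -> Derive (cx G) t <> 0 \/ Derive (cy G) t <> 0.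

Definition speed (G : curve) (t : R) : R :=
  sqrt (Derive (cx G) t ^ 2 + Derive (cy G) t ^ 2).

Definition curvature (G : curve) (t : R) : R :=
  Rabs (Derive (cx G) t * Derive_n (cy G) 2 t
        - Derive (cy G) t * Derive_n (cx G) 2 t) / speed G t ^ 3.

(* Where the curvature vanishes this is / 0 = 0, not infinity; a positive lower
   bound on it therefore forces the curvature to be nonzero. *)
Definition radius_of_curvature (G : curve) (t : R) : R := / curvature G t.

Definition curve_length (G : curve) : R :=
  RInt (speed G) (t_init G) (t_final G).

Definition has_initial_slope (G : curve) (w : R) : Prop :=
  Derive (cx G) (t_init G) <> 0 /\
  Derive (cy G) (t_init G) / Derive (cx G) (t_init G) = w.

Definition integer_lattice : Ensemble (R * R) :=
  fun p => exists m n : Z, p = (IZR m, IZR n).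

Definition lattice_point_count (G : curve) (n : nat) : Prop :=
  cardinal (R * R) (Intersection (R * R) (trace G) integer_lattice) n.

(* Main.v *)
Require Import Defs.
From Stdlib Require Import Reals ZArith Ensembles Finite_sets.
From Stdlib Require Import Finite_sets_facts Lra Lia.
From Coquelicot Require Import Coquelicot.
Open Scope R_scope.

(** Put [d = w - a/q] and parametrise a curve by [t = q y - a x], so that
    [y = (a x + t) / q], the integer points sit at integer [t], and on each line
    [t = k] their abscissae form a residue class modulo [q].  The slope is [w]
    exactly when [x' = 1 / (q d)], and the curvature is [|x''| / (q speed^3)].
    Start with a quadratic [x(t)] whose [x''] is of size [1 / (q^2 |d|^3 r)];
    since [q |d| r^(1/3) <= 1] this is at least of order [q].  Moving [x(20 k)]
    to the next point of its residue class costs at most [q], and doing so by C^2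
    bumps with disjoint supports alters [x''] by a small multiple of [q] only; it
    alters [x'] by a relative amount [O(q^2 |d|)], which is tiny because
    [l > K^2 r^(1/3)] and [q < K r^(2/3) / l], where [K = 800 C^4].  Letting [t]
    run up to [q |d| l / 1000] keeps [x'] nearly constant and gives one lattice
    point for every 20 units of [t]. *)

(** * A compactly supported C^2 bump *)

Definition pos (x : R) : R := Rmax 0 x.

Lemma pos_sq (x : R) : pos x ^ 2 = x * pos x.
Proof. unfold pos, Rmax; destruct (Rle_dec 0 x); ring. Qed.

Lemma is_derive_pos_sq (x : R) : is_derive (fun y => pos y ^ 2) x (2 * pos x).
Proof.
destruct (Rtotal_order x 0) as [Hx | [-> | Hx]].
- apply is_derive_ext_loc with (fun _ => 0).
  + apply (locally_interval _ x m_infty 0); simpl; auto.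
    intros y _ Hy; unfold pos; rewrite Rmax_left by lra; ring.
  + unfold pos; rewrite Rmax_left by lra; auto_derive; auto; ring.
(* At the junction the difference quotient is [pos h ^ 2 / h], of absolute value at most [|h|], so
   [e] itself serves as the radius. *)
- apply is_derive_Reals; unfold derivable_pt_lim; intros e He.
  exists (mkposreal e He); simpl; intros h Hh Hhe.
  unfold pos; rewrite Rplus_0_l, Rmult_1_r, (Rmax_left 0 0) by lra.
  apply Rle_lt_trans with (Rabs h); auto.
  unfold Rmax; destruct (Rle_dec 0 h).
  + right; f_equal; field; lra.
  + match goal with |- Rabs ?z <= _ => replace z with 0 by (field; lra) end.
    rewrite Rabs_R0; apply Rabs_pos.
- apply is_derive_ext_loc with (fun y => y ^ 2).
  + apply (locally_interval _ x 0 p_infty); simpl; auto.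
    intros y Hy _; unfold pos; rewrite Rmax_right by lra; ring.
  + unfold pos; rewrite Rmax_right by lra; auto_derive; auto; ring.
Qed.

Lemma is_derive_pos_cube (x : R) :
  is_derive (fun y => pos y ^ 3) x (3 * pos x ^ 2).
Proof.
(* With this factorisation the product rule replaces a second limit argument at 0. *)
apply is_derive_ext with (fun y => y * pos y ^ 2).
- intros y; unfold pos, Rmax; destruct (Rle_dec 0 y); simpl; ring.
- evar_last.
  + apply (is_derive_mult (fun y => y) (fun y => pos y ^ 2)).
    * apply is_derive_id.
    * apply is_derive_pos_sq.
    * intros; apply Rmult_comm.
  + unfold plus, mult, one; simpl; generalize (pos_sq x); simpl; lra.
Qed.

(** The cube is the least integer power of [pos] for which the second derivative is still continuous
    across [|s| = 1]. *)
Definition bump (s : R) : R := pos (1 - s ^ 2) ^ 3.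
Definition bump' (s : R) : R := -6 * s * pos (1 - s ^ 2) ^ 2.
Definition bump'' (s : R) : R :=
  -6 * pos (1 - s ^ 2) ^ 2 + 24 * s ^ 2 * pos (1 - s ^ 2).

Lemma is_derive_bump (s : R) : is_derive bump s (bump' s).
Proof.
unfold bump; evar_last.
- apply (is_derive_comp (fun y => pos y ^ 3) (fun s => 1 - s ^ 2)).
  + apply is_derive_pos_cube.
  + auto_derive; auto.
- unfold scal, bump'; simpl; unfold mult; simpl; ring.
Qed.

Lemma is_derive_bump' (s : R) : is_derive bump' s (bump'' s).
Proof.
unfold bump'; evar_last.
- apply (is_derive_mult (fun s => -6 * s) (fun s => pos (1 - s ^ 2) ^ 2)).
  + auto_derive; auto.
  + apply (is_derive_comp (fun y => pos y ^ 2) (fun s => 1 - s ^ 2)).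
    * apply is_derive_pos_sq.
    * auto_derive; auto.
  + intros; apply Rmult_comm.
- unfold scal, plus, bump''; simpl; unfold mult; simpl; ring.
Qed.

Lemma pos_outside (s : R) : 1 <= Rabs s -> pos (1 - s ^ 2) = 0.
Proof.
intros H; unfold pos; apply Rmax_left.
assert (E : s ^ 2 = Rabs s ^ 2) by (symmetry; apply pow2_abs).
rewrite E; nra.
Qed.

Lemma pos_cases (s : R) :
  pos (1 - s ^ 2) = 0 \/ pos (1 - s ^ 2) = 1 - s ^ 2 /\ 0 <= s ^ 2 <= 1.
Proof.
unfold pos, Rmax; destruct (Rle_dec 0 (1 - s ^ 2)); auto.
right; split; auto; nra.
Qed.

Lemma bump'_bound (s : R) : Rabs (bump' s) <= 6.
Proof.
unfold bump'; destruct (pos_cases s) as [-> | [-> H]]; apply Rabs_le; [lra |].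
assert (-1 <= s <= 1) by nra.
assert (0 <= (1 - s ^ 2) ^ 2 <= 1) by nra.
nra.
Qed.

Lemma bump''_bound (s : R) : Rabs (bump'' s) <= 24.
Proof.
unfold bump''; destruct (pos_cases s) as [-> | [-> H]]; apply Rabs_le; [lra |].
nra.
Qed.

(** * Trains of bumps with disjoint supports *)

Definition supported (F : R -> R) : Prop := forall s, 1 <= Rabs s -> F s = 0.

Lemma bump_supported : supported bump.
Proof. intros s H; unfold bump; rewrite pos_outside by auto; ring. Qed.

Lemma bump'_supported : supported bump'.
Proof. intros s H; unfold bump'; rewrite pos_outside by auto; ring. Qed.

Lemma bump''_supported : supported bump''.
Proof. intros s H; unfold bump''; rewrite pos_outside by auto; ring. Qed.

(** The centres are 2, 4, ..., 2n, so neighbouring supports share at most an endpoint, where [F]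
    vanishes. No bump is centred at 0, which leaves the initial point and slope of the curve
    untouched. *)
Fixpoint train (F : R -> R) (c : nat -> R) (n : nat) (s : R) : R :=
  match n with
  | O => 0
  | S m => train F c m s + c n * F (s - 2 * INR n)
  end.

Lemma train_right F c n s :
  supported F -> 2 * INR n + 1 <= s -> train F c n s = 0.
Proof.
intros HF; induction n as [|n IH]; intros Hs; cbn [train]; auto.
rewrite S_INR in Hs; rewrite IH by lra.
rewrite HF; [ring |].
rewrite S_INR, Rabs_right; lra.
Qed.

Lemma train_left F c n s : supported F -> s <= 1 -> train F c n s = 0.
Proof.
intros HF Hs; induction n as [|n IH]; cbn [train]; auto.
rewrite IH, HF; [ring |].
rewrite S_INR; generalize (pos_INR n); intros Hn.
rewrite Rabs_left1; lra.
Qed.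

Lemma train_node F c n j : supported F -> (1 <= j <= n)%nat ->
  train F c n (2 * INR j) = c j * F 0.
Proof.
intros HF; induction n as [|n IH]; intros Hj; [lia |]; cbn [train].
destruct (Nat.eq_dec j (S n)) as [-> | Hne].
- rewrite train_right by (auto; rewrite S_INR; lra).
  replace (2 * INR (S n) - 2 * INR (S n)) with 0 by ring; ring.
- rewrite IH by lia; rewrite (HF (_ - _)); [ring |].
  assert (H : INR j + 1 <= INR (S n)) by (rewrite <- S_INR; apply le_INR; lia).
  rewrite Rabs_left1; lra.
Qed.

(* The supports are disjoint, so at most one term contributes. *)
Lemma train_bound F c n B E s : supported F ->
  (forall x, Rabs (F x) <= B) -> (forall k, Rabs (c k) <= E) ->
  Rabs (train F c n s) <= E * B.
Proof.
intros HF HB HE.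
assert (HB0 : 0 <= B) by (eapply Rle_trans; [apply Rabs_pos | apply (HB 0)]).
assert (HE0 : 0 <= E) by (eapply Rle_trans; [apply Rabs_pos | apply (HE O)]).
induction n as [|n IH]; cbn [train].
- rewrite Rabs_R0; nra.
- destruct (Rle_dec s (2 * INR n + 1)) as [Hs | Hs].
  + rewrite (HF (_ - _)) by (rewrite S_INR, Rabs_left1; lra).
    rewrite Rmult_0_r, Rplus_0_r; auto.
  + rewrite train_right by (auto; lra).
    rewrite Rplus_0_l, Rabs_mult.
    apply Rmult_le_compat; auto using Rabs_pos.
Qed.

Lemma is_derive_train F F' c n s : (forall x, is_derive F x (F' x)) ->
  is_derive (train F c n) s (train F' c n s).
Proof.
intros HF; induction n as [|n IH]; cbn [train].
- apply (is_derive_const (K := R_AbsRing) (V := R_NormedModule)).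
- apply (is_derive_plus (train F c n) (fun s => c (S n) * F (s - 2 * INR (S n))));
    auto.
  apply is_derive_scal.
  evar_last.
  + apply (is_derive_comp F (fun s => s - 2 * INR (S n))); [apply HF |].
    auto_derive; auto.
  + unfold scal; simpl; unfold mult; simpl; ring.
Qed.

(** * Counting *)

Lemma finite_image {U : Type} (f : nat -> U) (n : nat) :
  Finite_sets.Finite U (fun p => exists k, (k < n)%nat /\ p = f k).
Proof.
induction n as [|n IH].
- replace (fun p => _) with (Empty_set U); [constructor |].
  apply Extensionality_Ensembles; split; intros p Hp; [destruct Hp |].
  destruct Hp as (k & Hk & _); lia.
- eapply Finite_downward_closed; [apply (Add_preserves_Finite _ _ (f n) IH) |].
  intros p (k & Hk & ->); destruct (Nat.eq_dec k n) as [-> | Hne].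
  + apply Add_intro2.
  + apply Add_intro1; exists k; split; auto; lia.
Qed.

Lemma cardinal_injection {U : Type} (A : Ensemble U) (f : nat -> U) (n N : nat) :
  cardinal U A N ->
  (forall k, (k < n)%nat -> In U A (f k)) ->
  (forall i j, (i < j < n)%nat -> f i <> f j) -> (n <= N)%nat.
Proof.
intros HA Hin Hinj.
assert (H : cardinal U (fun p => exists k, (k < n)%nat /\ p = f k) n).
{ clear Hin; induction n as [|n IH].
  - replace (fun p => _) with (Empty_set U); [constructor |].
    apply Extensionality_Ensembles; split; intros p Hp; [destruct Hp |].
    destruct Hp as (k & Hk & _); lia.
  - replace (fun p => exists k, (k < S n)%nat /\ p = f k)
      with (Add U (fun p => exists k, (k < n)%nat /\ p = f k) (f n)).
    + constructor.
      * apply IH; intros i j Hij; apply Hinj; lia.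
      * intros (k & Hk & Hf); apply (Hinj k n); auto; lia.
    + apply Extensionality_Ensembles; split; intros p Hp.
      * destruct Hp as [p (k & Hk & ->) | p Hp].
        -- exists k; split; auto.
        -- destruct Hp; exists n; split; auto.
      * destruct Hp as (k & Hk & ->).
        destruct (Nat.eq_dec k n) as [-> | Hne]; [apply Add_intro2 |].
        apply Add_intro1; exists k; split; auto; lia. }
apply (incl_card_le U _ A n N H HA).
intros p (k & Hk & ->); auto.
Qed.

(** * Curves sheared along a rational direction *)

Section Shear.

Variables (a q : Z) (X X' X'' : R -> R) (T : R).
Hypothesis hq : (1 <= q)%Z.
Hypothesis hT : 0 < T.
Hypothesis dX : forall t, is_derive X t (X' t).
Hypothesis dX' : forall t, is_derive X' t (X'' t).

Let Y (t : R) : R := (IZR a * X t + t) / IZR q.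
Let Y' (t : R) : R := (IZR a * X' t + 1) / IZR q.

(* The parameter of a point (x, y) is recovered as q y - a x. *)
Definition shear_curve : curve := Curve 0 T X Y hT.

Let G := shear_curve.

Let q_pos : 0 < IZR q.
Proof. apply (IZR_lt 0); lia. Qed.

Let dY t : is_derive Y t (Y' t).
Proof.
unfold Y, Y'; evar_last.
- apply (is_derive_ext (fun t => / IZR q * (IZR a * X t + t))).
  + intros s; simpl; field; lra.
  + apply is_derive_scal.
    apply (is_derive_plus (fun t => IZR a * X t) (fun t => t)).
    * apply is_derive_scal, dX.
    * apply is_derive_id.
- unfold plus, one; simpl; field; lra.
Qed.

Let dY' t : is_derive Y' t (IZR a * X'' t / IZR q).
Proof.
unfold Y'; evar_last.
- apply (is_derive_ext (fun t => / IZR q * (IZR a * X' t + 1))).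
  + intros s; simpl; field; lra.
  + apply is_derive_scal.
    apply (is_derive_plus (fun t => IZR a * X' t) (fun t => 1)).
    * apply is_derive_scal, dX'.
    * apply (is_derive_const (K := R_AbsRing) (V := R_NormedModule)).
- unfold plus, zero; simpl; field; lra.
Qed.

Lemma Derive_shear_x t : Derive (cx G) t = X' t.
Proof. apply is_derive_unique, dX. Qed.

Lemma Derive_shear_y t : Derive (cy G) t = (IZR a * X' t + 1) / IZR q.
Proof. apply is_derive_unique, dY. Qed.

Let ddX t : is_derive (Derive (cx G)) t (X'' t).
Proof.
apply is_derive_ext with X'; auto; intros s; symmetry; apply Derive_shear_x.
Qed.

Let ddY t : is_derive (Derive (cy G)) t (IZR a * X'' t / IZR q).
Proof.
apply is_derive_ext with Y'; auto; intros s; symmetry; apply Derive_shear_y.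
Qed.

Lemma shear_twice_differentiable : twice_differentiable G.
Proof.
intros t _; repeat split; eexists;
  [apply dX | apply dY | apply ddX | apply ddY].
Qed.

(** The terms in [X' X''] cancel in the determinant, leaving only [- X'' / q]. *)
Lemma shear_curvature t : curvature G t = Rabs (X'' t) / IZR q / speed G t ^ 3.
Proof.
unfold curvature; f_equal.
change (Derive_n (cx G) 2 t) with (Derive (Derive (cx G)) t).
change (Derive_n (cy G) 2 t) with (Derive (Derive (cy G)) t).
rewrite (is_derive_unique _ _ _ (ddX t)), (is_derive_unique _ _ _ (ddY t)).
rewrite Derive_shear_x, Derive_shear_y.
replace (_ - _) with (- (X'' t / IZR q)) by (field; lra).
rewrite Rabs_Ropp; unfold Rdiv; rewrite Rabs_mult, Rabs_inv, (Rabs_right (IZR q)) by lra.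
reflexivity.
Qed.

Lemma shear_length_le M :
  (forall t, 0 <= t <= T -> speed G t <= M) -> curve_length G <= T * M.
Proof.
intros HM; unfold curve_length; simpl.
assert (Hc : ex_RInt (speed G) 0 T).
{ apply (ex_RInt_continuous (V := R_CompleteNormedModule)); intros t _.
  unfold speed.
  apply (continuous_comp (fun t => Derive (cx G) t ^ 2 + Derive (cy G) t ^ 2) sqrt).
  - apply (continuous_plus (V := R_NormedModule)
      (fun t => Derive (cx G) t ^ 2) (fun t => Derive (cy G) t ^ 2)).
    + apply (continuous_comp (Derive (cx G)) (fun y => y ^ 2)).
      * apply (ex_derive_continuous (V := R_NormedModule)); eexists; apply ddX.
      * apply (ex_derive_continuous (V := R_NormedModule)); auto_derive; auto.
    + apply (continuous_comp (Derive (cy G)) (fun y => y ^ 2)).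
      * apply (ex_derive_continuous (V := R_NormedModule)); eexists; apply ddY.
      * apply (ex_derive_continuous (V := R_NormedModule)); auto_derive; auto.
  - apply continuous_sqrt. }
apply Rle_trans with (1 := Rle_abs _).
replace (T * M) with ((T - 0) * M) by ring.
apply abs_RInt_le_const; auto; [lra |].
intros t Ht; rewrite Rabs_right; auto.
apply Rle_ge, sqrt_pos.
Qed.

(** Solving for [t] gives [q y - a x]. Lattice points therefore occur only at integer parameters,
    and distinct parameters give distinct points: the first bounds the count above, the second
    below. *)
Lemma shear_param t m n :
  (X t, Y t) = (IZR m, IZR n) -> t = IZR (q * n - a * m).
Proof.
intros E; injection E as Ex Ey; rewrite minus_IZR, !mult_IZR, <- Ex, <- Ey.
unfold Y; field; lra.
Qed.

Lemma shear_finite : exists N, lattice_point_count G N.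
Proof.
apply finite_cardinal.
apply Finite_downward_closed with
  (A := fun p => exists k, (k < Z.to_nat (up T))%nat /\ p = (X (INR k), Y (INR k))).
{ apply finite_image. }
intros p Hp; destruct Hp as [p (t & Ht & ->) (m & n & E)].
unfold in_domain in Ht; simpl in *.
assert (Et := shear_param t m n E).
set (z := (q * n - a * m)%Z) in *.
assert (Hz : (0 <= z)%Z) by (apply le_IZR; lra).
(* Since [z <= T < up T], the strict bound [k < up T] still includes a parameter equal to [T]. *)
destruct (archimed T) as [Hup _].
assert (Hz' : (z < up T)%Z) by (apply lt_IZR; lra).
exists (Z.to_nat z); split; [lia |].
rewrite INR_IZR_INZ, Z2Nat.id, <- Et; auto.
Qed.

Lemma shear_count_ge (n N : nat) (h : nat) : (1 <= h)%nat ->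
  lattice_point_count G N ->
  (forall k, (k < n)%nat -> INR (h * k) <= T) ->
  (forall k, (k < n)%nat ->
     exists x y : Z, X (INR (h * k)) = IZR x /\ Y (INR (h * k)) = IZR y) ->
  (n <= N)%nat.
Proof.
intros Hh HN HT HL.
apply (cardinal_injection _ (fun k => (X (INR (h * k)), Y (INR (h * k)))) n N HN).
- intros k Hk; split.
  + exists (INR (h * k)); split; auto; split; simpl; [apply pos_INR | auto].
  + destruct (HL k Hk) as (x & y & -> & ->); exists x, y; auto.
- intros i j Hij E.
  destruct (HL i) as (x & y & Ex & Ey); [lia |].
  rewrite Ex, Ey in E.
  assert (Hi := shear_param (INR (h * i)) x y ltac:(congruence)).
  assert (Hj := shear_param (INR (h * j)) x y ltac:(congruence)).
  assert (INR (h * i) = INR (h * j)) as Hne by congruence.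
  apply INR_eq in Hne; nia.
Qed.

End Shear.

(** * Rounding to the lattice *)

(** By Bezout, [u - a b u = q e u], so [x = - b u] modulo [q] is the class that makes [a x + u]
    divisible by [q]. *)
Lemma lattice_on_line (a q b e u : Z) (z : Z) :
  (a * b + q * e = 1)%Z -> (1 <= q)%Z ->
  (IZR a * IZR (q * z - b * u) + IZR u) / IZR q = IZR (a * z + e * u).
Proof.
intros Hb Hq.
assert (Hq' : 0 < IZR q) by (apply (IZR_lt 0); lia).
rewrite <- mult_IZR, <- plus_IZR.
replace (a * (q * z - b * u) + u)%Z with (q * (a * z + e * u))%Z.
- rewrite mult_IZR; field; lra.
- replace u with ((a * b + q * e) * u)%Z at 3 by (rewrite Hb; ring); ring.
Qed.

(** The type is informative so that the choices for all [k] form a function. *)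
Lemma round_residue (q : Z) (c : Z) (x : R) : (1 <= q)%Z ->
  {z : Z | 0 <= IZR (q * z - c) - x <= IZR q}.
Proof.
intros Hq.
assert (Hq' : 0 < IZR q) by (apply (IZR_lt 0); lia).
destruct (archimed ((x + IZR c) / IZR q)) as [H1 H2].
set (v := (x + IZR c) / IZR q) in *.
assert (Hv : x + IZR c = IZR q * v) by (unfold v; field; lra).
exists (up v); rewrite minus_IZR, mult_IZR; nra.
Qed.

(** * Bending a parabola through lattice points *)

Section Construction.

Variables (r l w d : R) (a q : Z).
Let Q := IZR q.
Let dl := Rabs d.
Hypothesis hr : 0 < r.
Hypothesis hl : 0 < l.
Hypothesis hw : 0 < w < 1.
Hypothesis haq : Z.gcd a q = 1%Z.
Hypothesis hq : (1 <= q)%Z.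
Hypothesis hd : w - IZR a / Q = d.
Hypothesis hd0 : 0 < dl <= 1.
Hypothesis hld : l < 25 * r * dl.
Hypothesis hqd : 800 * (Q ^ 2 * dl) <= 1.
Hypothesis hqr : (Q * dl) ^ 3 * r <= 1.

Let m := / (Q * dl).
Let D := / (Q * d).
(* The factor 2 in [x''] balances the factor [(1 + slope^2)^(3/2)], which
   ranges over roughly [1, 2.83]. *)
Let beta := 2 * Q * m ^ 3 / r.
(** As [m Q dl = 1], a speed of at most [2 m] gives length at most [l / 500]. The denominator also
    keeps the drift [beta T] of the derivative below [m / 20]. *)
Let T := Q * dl * l / 1000.
(** The floor of [T / 20]: together with [k = 0] there are [n + 1 > T / 20] parameters [20 k] in
    [[0, T]]. *)
Let n := Z.to_nat (up (T / 20) - 1).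
Let base (t : R) : R := D * t + beta / 2 * t ^ 2.

Let Q_ge1 : 1 <= Q.
Proof. apply (IZR_le 1); auto. Qed.

Let d_neq0 : d <> 0.
Proof. intros E; unfold dl in hd0; rewrite E, Rabs_R0 in hd0; lra. Qed.

Let m_pos : 0 < m.
Proof. apply Rinv_0_lt_compat; nra. Qed.

Let m_def : m * (Q * dl) = 1.
Proof. apply Rinv_l; nra. Qed.

Let T_pos : 0 < T.
Proof. unfold T; assert (0 < Q * dl) by nra; nra. Qed.

Let abs_D : Rabs D = m.
Proof.
unfold D, m, dl; rewrite Rabs_inv, Rabs_mult, (Rabs_right Q) by lra; auto.
Qed.

(** [hqr] says [r <= m ^ 3]. This lets [beta] absorb the second derivatives of bumps of height at
    most [Q]. *)
Let beta_ge : 2 * Q <= beta.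
Proof.
assert (H : 1 <= m ^ 3 / r).
{ apply Rmult_le_reg_r with r; auto; unfold Rdiv.
  rewrite Rmult_assoc, Rinv_l by lra.
  assert (E : m ^ 3 * (Q * dl) ^ 3 = 1) by (rewrite <- Rpow_mult_distr, m_def; ring).
  assert (0 < m ^ 3) by (apply pow_lt; auto).
  nra. }
unfold beta; replace (2 * Q * m ^ 3 / r) with (2 * Q * (m ^ 3 / r)) by (field; lra).
nra.
Qed.

Let beta_T : beta * T <= m / 20.
Proof.
assert (E : beta * T = 2 * (Q * m) * m * (m * (Q * dl)) * (l / r) / 1000)
  by (unfold beta, T; field; lra).
rewrite E, m_def.
assert (Hlr : l / r <= 25 * dl).
{ apply Rmult_le_reg_r with r; auto.
  unfold Rdiv; rewrite Rmult_assoc, Rinv_l by lra; lra. }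
assert (0 < Q * m) by nra.
replace (2 * (Q * m) * m * 1 * (l / r) / 1000)
  with (m * ((Q * m) * (l / r)) / 500) by (field; lra).
assert ((Q * m) * (l / r) <= 25).
{ apply Rle_trans with ((Q * m) * (25 * dl)); [apply Rmult_le_compat_l; lra |].
  lra. }
nra.
Qed.

(** This is [hqd] multiplied by [m]; it makes the effect of the bumps on [X'] negligible against
    [m]. *)
Let Q_small : 800 * Q <= m.
Proof.
apply Rle_trans with (m * (800 * (Q ^ 2 * dl))).
- replace (m * (800 * (Q ^ 2 * dl))) with (800 * Q * (m * (Q * dl))) by ring.
  rewrite m_def; lra.
- rewrite <- (Rmult_1_r m) at 2; apply Rmult_le_compat_l; lra.
Qed.

Lemma construction : exists G : curve,
  (twice_differentiable G /\ regular G /\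
   forall t, in_domain G t -> r / 16 <= radius_of_curvature G t <= 16 * r) /\
  curve_length G < l /\
  has_initial_slope G w /\
  exists N : nat, lattice_point_count G N /\
    1 <= INR N /\ Q * l * dl / 20000 <= INR N.
Proof.
destruct (Z.gcd_bezout a q 1 haq) as (b & e & Hbez).
(* On the line [t = 20 k] the lattice abscissae are the integers congruent to [- b (20 k)] modulo
   [q]; the parabola is rounded up to the next one. *)
set (zz k := round_residue q (b * Z.of_nat (20 * k)) (base (INR (20 * k))) hq).
set (c k := IZR (q * proj1_sig (zz k) - b * Z.of_nat (20 * k)) - base (INR (20 * k))).
assert (Hc : forall k, Rabs (c k) <= Q).
{ intros k; unfold c; destruct (zz k) as [z Hz]; simpl proj1_sig.
  rewrite Rabs_right; unfold Q; lra. }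
(* The scaling by 10 moves the centre [2 k] to [t = 20 k] and gains factors 1/10 and 1/100 in the
   first two derivatives. *)
set (X t := base t + train bump c n (t / 10)).
set (X' t := D + beta * t + train bump' c n (t / 10) / 10).
set (X'' t := beta + train bump'' c n (t / 10) / 100).
assert (dX : forall t, is_derive X t (X' t)).
{ intros t; unfold X, X'; apply (is_derive_plus base (fun t => train bump c n (t / 10))).
  - unfold base; auto_derive; auto; field.
  - evar_last.
    + apply (is_derive_comp (train bump c n) (fun t => t / 10)).
      * apply is_derive_train, is_derive_bump.
      * auto_derive; auto.
    + unfold scal; simpl; unfold mult; simpl; field. }
assert (dX' : forall t, is_derive X' t (X'' t)).
{ intros t; unfold X', X''.
  apply (is_derive_plus (fun t => D + beta * t) (fun t => train bump' c n (t / 10) / 10)).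
  - auto_derive; auto; field.
  - evar_last.
    + apply (is_derive_ext (fun t => / 10 * train bump' c n (t / 10))).
      { intros s; simpl; field. }
      apply is_derive_scal.
      apply (is_derive_comp (train bump' c n) (fun t => t / 10)).
      * apply is_derive_train, is_derive_bump'.
      * auto_derive; auto.
    + unfold scal; simpl; unfold mult; simpl; field. }
assert (HX' : forall t, 0 <= t <= T -> Rabs (X' t - D) <= m / 10).
{ intros t Ht; unfold X'.
  (* The bumps contribute at most [6 Q / 10 <= 6 m / 8000], the parabola at most [m / 20]. *)
  assert (Hb := train_bound bump' c n 6 Q (t / 10) bump'_supported bump'_bound Hc).
  apply Rabs_le_between in Hb; apply Rabs_le.
  assert (0 <= beta * t <= beta * T) by nra.
  lra. }
assert (HX'' : forall t, 88 / 100 * beta <= X'' t <= 112 / 100 * beta).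
{ intros t; unfold X''.
  (* Here [24 Q / 100 <= 12 beta / 100] by [beta_ge]. *)
  assert (Hb := train_bound bump'' c n 24 Q (t / 10) bump''_supported bump''_bound Hc).
  apply Rabs_le_between in Hb; lra. }
set (G := shear_curve a q X T T_pos).
assert (Hspeed : forall t, 0 <= t <= T -> 9 / 10 * m <= speed G t <= 2 * m).
{ intros t Ht; unfold speed, G.
  rewrite (Derive_shear_x a q X X' T T_pos dX), (Derive_shear_y a q X X' T hq T_pos dX).
  fold Q; specialize (HX' t Ht).
  (* Substituting [a / q = w - d] and [1 / q = d D] expresses [y'] as [w x'] plus an error
     controlled by [X' - D]. *)
  assert (EY : (IZR a * X' t + 1) / Q = w * X' t - d * (X' t - D)).
  { rewrite <- hd; unfold D; rewrite <- hd; field; split; [lra |].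
    intros E; apply d_neq0; rewrite <- hd; field_simplify; [rewrite E; field |]; lra. }
  assert (HXu : Rabs (X' t) <= 11 / 10 * m).
  { replace (X' t) with (D + (X' t - D)) by ring.
    apply Rle_trans with (1 := Rabs_triang _ _); rewrite abs_D; lra. }
  assert (HXl : 9 / 10 * m <= Rabs (X' t)).
  { replace (X' t) with (D - (D - X' t)) by ring.
    apply Rle_trans with (2 := Rabs_triang_inv _ _).
    rewrite (Rabs_minus_sym D), abs_D; lra. }
  assert (HY : Rabs ((IZR a * X' t + 1) / Q) <= 12 / 10 * m).
  { rewrite EY; unfold Rminus at 1.
    apply Rle_trans with (1 := Rabs_triang _ _).
    rewrite Rabs_Ropp, !Rabs_mult, (Rabs_right w) by lra; fold dl.
    assert (w * Rabs (X' t) <= 1 * (11 / 10 * m))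
      by (apply Rmult_le_compat; try lra; apply Rabs_pos).
    assert (dl * Rabs (X' t - D) <= 1 * (m / 10))
      by (apply Rmult_le_compat; try lra; apply Rabs_pos).
    lra. }
  rewrite <- (pow2_abs (X' t)), <- (pow2_abs (_ / Q)).
  assert (H0 := Rabs_pos ((IZR a * X' t + 1) / Q)).
  split.
  - rewrite <- (sqrt_pow2 (9 / 10 * m)) by lra; apply sqrt_le_1_alt; nra.
  - rewrite <- (sqrt_pow2 (2 * m)) by lra; apply sqrt_le_1_alt; nra. }
assert (HX'0 : forall t, 0 <= t <= T -> X' t <> 0).
{ intros t Ht E; specialize (HX' t Ht); rewrite E, Rminus_0_l, Rabs_Ropp, abs_D in HX'.
  lra. }
exists G; split; [split; [| split] | split; [| split]].
- apply (shear_twice_differentiable a q X X' X'' T hq T_pos dX dX').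
- intros t Ht; left; unfold G.
  rewrite (Derive_shear_x a q X X' T T_pos dX); apply HX'0, Ht.
- intros t Ht; unfold radius_of_curvature, G.
  rewrite (shear_curvature a q X X' X'' T hq T_pos dX dX'); fold Q G.
  specialize (Hspeed t Ht); specialize (HX'' t).
  rewrite Rabs_right by lra.
  set (v := speed G t) in *.
  assert (Hm3 : 0 < m ^ 3) by (apply pow_lt; auto).
  assert (Hv1 : (9 / 10 * m) ^ 3 <= v ^ 3) by (apply pow_incr; lra).
  assert (Hv2 : v ^ 3 <= (2 * m) ^ 3) by (apply pow_incr; lra).
  rewrite Rpow_mult_distr in Hv1, Hv2.
  set (A := X'' t / Q).
  (* The radius is [v ^ 3 / A], hence between [(0.729 / 2.24) r] and [(8 / 1.76) r], well inside the
     required range. *)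
  assert (HA : 176 / 100 * m ^ 3 <= A * r <= 224 / 100 * m ^ 3).
  { assert (E : beta / Q * r = 2 * m ^ 3) by (unfold beta; field; lra).
    assert (Hi : 0 < / Q * r) by (apply Rmult_lt_0_compat; auto; apply Rinv_0_lt_compat; lra).
    unfold A, Rdiv in *; rewrite Rmult_assoc in *.
    nra. }
  assert (HA0 : 0 < A) by nra.
  replace (/ (A / v ^ 3)) with (v ^ 3 / A) by (field; split; nra).
  split.
  + apply Rmult_le_reg_r with A; auto; unfold Rdiv.
    rewrite (Rmult_assoc (v ^ 3)), Rinv_l by lra; lra.
  + apply Rmult_le_reg_r with A; auto; unfold Rdiv.
    rewrite (Rmult_assoc (v ^ 3)), Rinv_l by lra; lra.
- apply Rle_lt_trans with (T * (2 * m)).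
  + apply (shear_length_le a q X X' X'' T hq T_pos dX dX').
    intros t Ht; apply Hspeed, Ht.
  + replace (T * (2 * m)) with (l * (m * (Q * dl)) / 500) by (unfold T; field).
    rewrite m_def; lra.
- assert (HX0 : X' 0 = D).
  { unfold X'; rewrite train_left by (try apply bump'_supported; lra); field. }
  unfold has_initial_slope, G.
  rewrite (Derive_shear_x a q X X' T T_pos dX), (Derive_shear_y a q X X' T hq T_pos dX).
  simpl t_init; split; [apply HX'0; lra |].
  rewrite HX0; fold Q; unfold D.
  replace w with (IZR a / Q + d) by lra; field; split; lra.
- destruct (shear_finite a q X T hq T_pos) as [N HN].
  exists N; split; auto.
  destruct (archimed (T / 20)) as [Hu1 Hu2].
  assert (Hu : (1 <= up (T / 20))%Z).
  { assert (0 < up (T / 20))%Z by (apply lt_IZR; lra); lia. }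
  assert (En : INR n = IZR (up (T / 20)) - 1).
  { unfold n; rewrite INR_IZR_INZ, Z2Nat.id, minus_IZR by lia; auto. }
  assert (HnN : (S n <= N)%nat).
  { apply (shear_count_ge a q X T hq T_pos (S n) N 20); auto; [lia | |].
    - intros k Hk; rewrite mult_INR.
      assert (INR k <= INR n) by (apply le_INR; lia).
      replace (INR 20) with 20 by (simpl; ring); lra.
    (* The train has no bump at [k = 0]; there the curve starts at the origin, already a lattice
       point. *)
    - intros k Hk; destruct (Nat.eq_dec k 0) as [-> | Hk0].
      + exists 0%Z, 0%Z.
        assert (X 0 = 0).
        { unfold X, base; rewrite train_left by (try apply bump_supported; lra); ring. }
        replace (INR (20 * 0)) with 0 by (simpl; ring).
        split; auto; rewrite H; fold Q; field; lra.
      + assert (EX : X (INR (20 * k)) = IZR (q * proj1_sig (zz k) - b * Z.of_nat (20 * k))).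
        { unfold X; replace (INR (20 * k) / 10) with (2 * INR k)
            by (rewrite mult_INR; simpl; field).
          rewrite train_node by (try apply bump_supported; lia).
          replace (bump 0) with 1
            by (unfold bump, pos; rewrite Rmax_right by lra; ring).
          unfold c; ring. }
        rewrite EX; generalize (proj1_sig (zz k)); intros z; eexists.
        exists (a * z + e * Z.of_nat (20 * k))%Z; split; [reflexivity |].
        rewrite (INR_IZR_INZ (20 * k)); apply lattice_on_line with (e := e); auto; lia. }
  apply le_INR in HnN; rewrite S_INR in HnN; generalize (pos_INR n); intros Hn.
  split; [lra |].
  apply Rle_trans with (T / 20); [unfold T; right; field | lra].
Qed.

End Construction.

(** * Scale estimates in powers of [r^(1/3)] *)

Theorem mainTheorem12 (C r l w : R) (a q : Z)
  (hC : 1 < C) (hr : 1 < r) (hl : 1 < l)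
  (hl_low : (800 * C ^ 4) ^ 2 * Rpower r (1 / 3) < l)
  (hl_up : l < Rpower r (2 / 3))
  (hw : 0 < w < 1)
  (haq : Z.gcd a q = 1%Z)
  (hq_low : (1 <= q)%Z)
  (hq_up : IZR q < 800 * C ^ 4 * Rpower r (2 / 3) / l)
  (hw_low : l / (25 * r) < Rabs (w - IZR a / IZR q))
  (hw_up : Rabs (w - IZR a / IZR q) <= 1 / (IZR q * Rpower r (1 / 3))) :
  exists G : curve,
    (twice_differentiable G /\ regular G /\
     forall t, in_domain G t ->
       r / 16 <= radius_of_curvature G t <= 16 * r) /\
    curve_length G < l /\
    has_initial_slope G w /\
    exists N : nat, lattice_point_count G N /\
      INR N >= 1 / 4 + 1 / 4 * (1 / (800 * C ^ 4) ^ 6)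
                 * (IZR q * l * Rabs (w - IZR a / IZR q)).
Proof.
assert (HC4 : 1 < C ^ 4) by (apply Rlt_pow_R1; auto; lia).
set (K := 800 * C ^ 4) in *.
assert (HK : 800 < K) by (unfold K; lra).
set (p := Rpower r (1 / 3)) in *.
assert (Hp : 0 < p) by apply exp_pos.
assert (Hp3 : p ^ 3 = r).
{ unfold p; rewrite <- Rpower_pow by apply exp_pos; rewrite Rpower_mult.
  replace (1 / 3 * INR 3) with 1 by (simpl; field); apply Rpower_1; lra. }
assert (Hp2 : Rpower r (2 / 3) = p ^ 2).
{ unfold p; rewrite <- Rpower_pow by apply exp_pos; rewrite Rpower_mult.
  f_equal; simpl; field. }
rewrite Hp2 in *.
set (dl := Rabs (w - IZR a / IZR q)) in *.
assert (HQ : 1 <= IZR q) by (apply (IZR_le 1); auto).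
set (Q := IZR q) in *.
assert (Hld : l < 25 * r * dl).
{ apply Rmult_lt_compat_r with (r := 25 * r) in hw_low; [| lra].
  unfold Rdiv in hw_low; rewrite Rmult_assoc, Rinv_l in hw_low; lra. }
assert (Hdl : 0 < dl) by nra.
assert (Hqdp : Q * dl * p <= 1).
{ apply Rmult_le_compat_r with (r := Q * p) in hw_up; [| nra].
  unfold Rdiv in hw_up; rewrite Rmult_assoc, Rinv_l in hw_up; nra. }
assert (HQl : Q * l < K * p ^ 2).
{ apply Rmult_lt_compat_r with (r := l) in hq_up; [| lra].
  unfold Rdiv in hq_up; rewrite Rmult_assoc, Rinv_l in hq_up; lra. }
(* Combine [K ^ 2 p < l] with [Q l < K p ^ 2]. With [Q dl p <= 1] this yields
   [800 Q ^ 2 dl <= 1]. *)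
assert (HQK : Q * K < p).
{ apply Rmult_lt_reg_r with (K * p); [nra |].
  apply Rle_lt_trans with (Q * l); [nra | nra]. }
destruct (construction r l w (w - IZR a / IZR q) a q) as
  (G & HG & Hlen & Hslope & N & HN & HN1 & HN2); auto; try lra; fold Q dl.
- split; auto.
  assert (800 < p) by nra.
  assert (0 < Q * dl) by nra.
  nra.
- assert (Q * (Q * dl * p) <= Q * 1) by (apply Rmult_le_compat_l; lra).
  assert (800 * (Q ^ 2 * dl) * p <= 1 * p) by nra.
  apply Rmult_le_reg_r with p; auto.
- rewrite <- Hp3, <- Rpow_mult_distr, <- (pow1 3).
  apply pow_incr; split; auto.
  assert (0 < Q * dl) by nra; nra.
- exists G; repeat (split; auto).
  exists N; split; auto; apply Rle_ge.
  fold Q dl in HN2.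
  (* A quarter of [HN1] supplies the constant term of the bound, and a quarter of [HN2] the other,
     since [K ^ 6] far exceeds 20000. *)
  assert (HK6 : 1 / K ^ 6 <= 1 / 20000).
  { unfold Rdiv; rewrite !Rmult_1_l; apply Rinv_le_contravar; [lra |].
    apply Rle_trans with (800 ^ 6); [lra | apply pow_incr; lra]. }
  assert (0 < Q * l * dl) by (apply Rmult_lt_0_compat; nra).
  assert (1 / K ^ 6 * (Q * l * dl) <= 1 / 20000 * (Q * l * dl))
    by (apply Rmult_le_compat_r; lra).
  lra.
Qed.
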